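(* Let $(\mathbb{X},(-)^\dagger,\iota,\varphi)$ be a unitary category. Then $\mathbb{X}$ is an inner product category with the inner product combinator defined, for $f:A\to X$ and $g:B\to X$, by $$\langle f|g\rangle := f\,\varphi_X\,g^\dagger:A\to B^\dagger.$$
   Context: Composition is written in diagrammatic order: $fg$ means first $f$, then $g$. An involutive category $(\mathbb{X},(-)^\dagger,\iota)$ is a category $\mathbb{X}$ with a functor $(-)^\dagger:\mathbb{X}^{\mathrm{op}}\to\mathbb{X}$ and a natural isomorphism $\iota_X:X\to X^{\dagger\dagger}$ such that $\iota_{X^\dagger}(\iota_X)^\dagger=1_{X^\dagger}$. A unitary category is an involutive category with a family of isomorphisms $\varphi_X:X\to X^\dagger$, one for each object (not assumed natural), such that [U.1] $\varphi_{X^\dagger}=(\varphi_X^{-1})^\dagger$ and [U.2] $\varphi_X\varphi_{X^\dagger}=\iota_X$. An inner product category is an involutive category with a combinator assigning to each pair $f:A\to X$, $g:B\to X$ a map $\langle f|g\rangle:A\to B^\dagger$ satisfying the axioms below, where for $h:X\to A$, $k:X\to B$ the dual inner product is $\langle h|k\rangle^\iota := \iota_{A^\dagger}\,\langle k^\dagger|h^\dagger\rangle^\dagger\,\iota_B^{-1}:A^\dagger\to B$: [IP.1] $\langle hf|kg\rangle = h\langle f|g\rangle k^\dagger$ for $f:A\to X$, $g:B\to X$, $h:Y\to A$, $k:Z\to B$; [IP.2](a) $\iota_A\langle f^\dagger|g^\dagger\rangle^\iota=\langle f|g\rangle$ and (b) $\iota_B\langle f|g\rangle^\dagger=\langle g|f\rangle$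 for $f:A\to X$, $g:B\to X$; [IP.3] $\langle f|g\rangle\langle h|k\rangle^\iota = fk$ for $f:A\to X$, $g:B\to X$, $h,k:X\to B$ with $hg=1_X$; [IP.4] $\langle f|g\rangle^\iota\langle h|k\rangle=(kf)^\dagger$ for $f:A\to Z$, $g:A\to X$, $h,k:X\to A$ with $gh=1_A$. *)

(* Defs.v *)
Set Implicit Arguments.
Unset Strict Implicit.
Unset Printing Implicit Defensive.

Declare Scope cat_scope.
Delimit Scope cat_scope with cat.

Reserved Notation "f ;; g" (at level 40, left associativity).

(** Composition is diagrammatic throughout: [f ;; g] is first [f], then [g]. *)

Record category := Category {
  obj :> Type;
  hom : obj -> obj -> Type;
  id : forall A, hom A A;
  comp : forall A B C, hom A B -> hom B C -> hom A C;
  comp1m : forall A B (f : hom A B), comp (id A) f = f;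
  compm1 : forall A B (f : hom A B), comp f (id B) = f;
  compA : forall A B C D (f : hom A B) (g : hom B C) (h : hom C D),
    comp (comp f g) h = comp f (comp g h)
}.

Arguments hom {c} A B.
Arguments id {c} A.
Arguments comp {c A B C} f g.

Notation "f ;; g" := (comp f g) : cat_scope.
Open Scope cat_scope.

Definition op (C : category) : category :=
  @Category (obj C) (fun A B => @hom C B A) (fun A => id A)
    (fun _ _ _ f g => comp g f)
    (fun _ _ f => compm1 f)
    (fun _ _ f => comp1m f)
    (fun _ _ _ _ f g h => eq_sym (compA h g f)).

Record functor (C D : category) := Functor {
  fobj :> C -> D;
  fmap : forall A B : C, hom A B -> hom (fobj A) (fobj B);
  fmap_id : forall A : C, fmap (id A) = id (fobj A);
  fmap_comp : forall (A B E : C) (f : hom A B) (g : hom B E),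
    fmap (f ;; g) = fmap f ;; fmap g
}.

Arguments fmap {C D} F {A B} f : rename.

Definition id_functor (C : category) : functor C C :=
  @Functor C C (fun A => A) (fun _ _ f => f)
    (fun _ => eq_refl) (fun _ _ _ _ _ => eq_refl).

(** A contravariant functor [C^op -> C], composed with itself, is a covariant
    endofunctor of [C]. *)
Definition contra_square (C : category) (F : functor (op C) C) : functor C C :=
  @Functor C C (fun A => F (F A))
    (fun A B f => @fmap (op C) C F (F A) (F B) (@fmap (op C) C F B A f))
    (fun A => eq_trans (f_equal (@fmap (op C) C F (F A) (F A))
                          (@fmap_id (op C) C F A))
                (@fmap_id (op C) C F (F A)))
    (fun A B E f g => eq_trans (f_equal (@fmap (op C) C F (F A) (F E))
                                  (@fmap_comp (op C) C F E B A g f))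
                        (@fmap_comp (op C) C F (F A) (F B) (F E)
                           (@fmap (op C) C F B A f)
                           (@fmap (op C) C F E B g))).

Record iso (C : category) (A B : C) := Iso {
  iso_hom :> hom A B;
  iso_inv : hom B A;
  iso_homK : iso_hom ;; iso_inv = id A;
  iso_invK : iso_inv ;; iso_hom = id B
}.

Record nat_iso (C D : category) (F G : functor C D) := NatIso {
  component :> forall A : C, iso (F A) (G A);
  naturality : forall (A B : C) (f : hom A B),
    fmap F f ;; component B = component A ;; fmap G f
}.

Record involutive_category := InvolutiveCategory {
  inv_cat :> category;
  dag : functor (op inv_cat) inv_cat;
  iota : nat_iso (id_functor inv_cat) (contra_square dag);
  iota_dag : forall X : inv_cat,
    iota (dag X) ;; @fmap (op inv_cat) inv_cat dag (dag (dag X)) X (iota X)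
      = id (dag X)
}.

Definition dagger (X : involutive_category) (A B : X) (f : hom A B) :
    hom (dag X B) (dag X A) :=
  @fmap (op X) X (dag X) B A f.

Record unitary_category := UnitaryCategory {
  uni_cat :> involutive_category;
  phi : forall A : uni_cat, iso A (dag uni_cat A);
  phi_dag : forall A : uni_cat,
    iso_hom (phi (dag uni_cat A)) = dagger (iso_inv (phi A));
  phi_phi : forall A : uni_cat,
    phi A ;; phi (dag uni_cat A) = iota uni_cat A
}.

(** [ip f g] is the inner product of [f : A -> X] and [g : B -> X]. *)
Definition ip_combinator (X : involutive_category) :=
  forall A B Y : X, hom A Y -> hom B Y -> hom A (dag X B).

Definition dual_ip (X : involutive_category) (ip : ip_combinator X)
    (Y A B : X) (h : hom Y A) (k : hom Y B) : hom (dag X A) B :=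
  iota X (dag X A) ;; dagger (ip _ _ _ (dagger k) (dagger h))
    ;; iso_inv (iota X B).

(** An inner product category is an involutive category [X] together with a
    combinator [ip] satisfying [is_inner_product ip]. *)
Record is_inner_product (X : involutive_category) (ip : ip_combinator X) :
    Prop := IsInnerProduct {
  ip_sesqui : forall (A B Y W Z : X)
      (f : hom A Y) (g : hom B Y) (h : hom W A) (k : hom Z B),
    ip _ _ _ (h ;; f) (k ;; g) = h ;; ip _ _ _ f g ;; dagger k;
  ip_dual : forall (A B Y : X) (f : hom A Y) (g : hom B Y),
    iota X A ;; dual_ip ip (dagger f) (dagger g) = ip _ _ _ f g;
  ip_sym : forall (A B Y : X) (f : hom A Y) (g : hom B Y),
    iota X B ;; dagger (ip _ _ _ f g) = ip _ _ _ g f;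
  ip_cancel : forall (A B Y : X)
      (f : hom A Y) (g : hom B Y) (h k : hom Y B),
    h ;; g = id Y -> ip _ _ _ f g ;; dual_ip ip h k = f ;; k;
  ip_dual_cancel : forall (A Y Z : X)
      (f : hom A Z) (g : hom A Y) (h k : hom Y A),
    g ;; h = id A -> dual_ip ip f g ;; ip _ _ _ h k = dagger (k ;; f)
}.

(* Main.v *)
Require Import Defs.
From Stdlib Require Import ssreflect.

(** Writing [φ_†] for [φ] at a dual object, [U.1] makes [φ_†] inverse to [φ^†].
    Sliding [iota] past double daggers and expanding [iota = φ φ_†] then collapses
    the dual inner product of [h] and [k] to [h^† φ^{-1} k], after which each
    axiom is a cancellation of [φ] against [φ^{-1}]. *)

Section Involutive.
Variable X : involutive_category.

Lemma dagger_id (A : X) : dagger (id A) = id (dag X A).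
Proof. exact (fmap_id (dag X) A). Qed.

Lemma dagger_comp (A B E : X) (f : hom A B) (g : hom B E) :
  dagger (f ;; g) = dagger g ;; dagger f.
Proof. exact (fmap_comp (dag X) (A := E) (B := B) (E := A) g f). Qed.

Lemma iota_natural (A B : X) (f : hom A B) :
  iota X A ;; dagger (dagger f) = f ;; iota X B.
Proof. exact (eq_sym (naturality (iota X) f)). Qed.

(** Naturality of [iota] conjugated by its inverses; it moves the final inverse in [dual_ip]
    leftwards. *)
Lemma dagger_dagger_iota_inv (A B : X) (f : hom A B) :
  dagger (dagger f) ;; iso_inv (iota X B) = iso_inv (iota X A) ;; f.
Proof.
rewrite -[LHS]comp1m -(iso_invK (iota X A)) compA -(compA (iota X A)).
by rewrite iota_natural compA (iso_homK (iota X B)) compm1.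
Qed.

End Involutive.

Section Unitary.
Variable U : unitary_category.

Definition unitary_ip : ip_combinator U :=
  fun A B X f g => f ;; phi X ;; dagger g.

Lemma phi_dagger_phi (A : U) :
  phi (dag U A) ;; dagger (phi A) = id (dag U A).
Proof. by rewrite phi_dag -dagger_comp iso_homK dagger_id. Qed.

(** Splitting [iota] by [U.2] leaves [phi (dag U A)] against [dagger (phi A)], which cancel. *)
Lemma iota_dagger_phi (A : U) : iota U A ;; dagger (phi A) = phi A.
Proof. by rewrite -phi_phi compA phi_dagger_phi compm1. Qed.

Lemma phi_iota_inv (A : U) :
  phi (dag U A) ;; iso_inv (iota U A) = iso_inv (phi A).
Proof.
rewrite -[LHS]comp1m -(iso_invK (phi A)) compA -(compA (phi A)) phi_phi.
by rewrite (iso_homK (iota U A)) compm1.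
Qed.

Lemma dual_unitary_ip (Y A B : U) (h : hom Y A) (k : hom Y B) :
  dual_ip unitary_ip h k = dagger h ;; iso_inv (phi Y) ;; k.
Proof.
rewrite /dual_ip /unitary_ip !dagger_comp -!compA iota_natural.
(* The first [iota] is absorbed, leaving [phi (dag U Y)]; the inverse of [iota] will turn it into
   [iso_inv (phi Y)]. *)
rewrite (compA (dagger h) (iota U _)) iota_dagger_phi compA.
by rewrite dagger_dagger_iota_inv -compA (compA _ (phi _)) phi_iota_inv.
Qed.

End Unitary.

Theorem lemma4p5 (U : unitary_category) :
  @is_inner_product U
    (fun (A B X : U) (f : hom A X) (g : hom B X) => f ;; phi X ;; dagger g).
Proof.
change (is_inner_product (unitary_ip U)).
split=> [A B Y W Z f g h k|A B Y f g|A B Y f g|A B Y f g h k hg|A Y Z f g h k gh];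
  rewrite ?dual_unitary_ip /unitary_ip.
- by rewrite dagger_comp !compA.
(* The dual form is taken at [dag U Y], so its inverse cancels the second factor of [iota]. *)
- rewrite -!compA iota_natural -phi_phi -!compA.
  by rewrite (compA _ (phi (dag U Y))) iso_homK compm1.
- by rewrite !dagger_comp -!compA iota_natural (compA g (iota _ _)) iota_dagger_phi.
(* [dagger g ;; dagger h] is the dagger of [h ;; g], so [phi] meets its inverse. *)
- rewrite -!compA (compA _ (dagger g)) -dagger_comp hg dagger_id compm1.
  by rewrite (compA f) iso_homK compm1.
- rewrite -!compA (compA _ g) gh compm1 (compA (dagger f)) iso_invK compm1.
  by rewrite dagger_comp.
Qed.
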